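(* Let $d\ge1$ be an integer and $\mu\in[0,1)$. Let $h(z_1,\dots,z_d)=\sum_{k\in[n]^d}c_kz_1^{k_1}\cdots z_d^{k_d}$ be a nonzero $n^\mu$-sparse polynomial with each $c_k\in\{0,\pm1\}$. Then for any $\Delta\ge1$ and any $L$ with $1\le L\le n^\Delta$, $$\max_{z_1,\dots,z_d\in\gamma(L)}|h(z_1,\dots,z_d)|\ \ge\ e^{-O(\Delta L n^{1-\mu}\log n)},$$ where the constant implied by $O(\cdot)$ depends only on $d$ and $\mu$.
   Context: $[n]=\{0,1,\dots,n-1\}$, and for $L\ge1$, $\gamma(L)=\{e^{i\theta}:-\pi/L\le\theta\le\pi/L\}\subset\mathbb{C}$. A polynomial $h=\sum_{k\in[n]^d}c_kz_1^{k_1}\cdots z_d^{k_d}$ with all $c_k\in\{0,\pm1\}$ is called $s$-sparse (for a real $s\ge0$) if for any two distinct indices $k,k'\in[n]^d$ with $c_k=c_{k'}\ne0$ there is some $1\le j\le d$ with $|k_j-k'_j|\ge s$. *)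

(* Defs.v *)
From HB Require Import structures.
From mathcomp Require Import all_boot all_order all_algebra.
From mathcomp Require Import all_classical all_reals all_analysis.
From mathcomp Require Import complex.
From mathcomp Require mpoly.
(* The notations of mpoly clash with those of mathcomp-analysis. *)
Import -(notations) mpoly.

Set Implicit Arguments.
Unset Strict Implicit.
Unset Printing Implicit Defensive.

Import Order.TTheory GRing.Theory Num.Theory.

Local Open Scope classical_set_scope.
Local Open Scope ring_scope.
Local Open Scope complex_scope.

(* The point e^{i theta}. *)
Definition expi (R : realType) (theta : R) : R[i] := cos theta +i* sin theta.

Definition gamma (R : realType) (L : R) : set R[i] :=
  [set expi theta | theta in [set theta : R | - (pi / L) <= theta <= pi / L]].

(* sum_{k in [n]^d} c_k z_1^{k_1} ... z_d^{k_d}; here 'I_n = {0, ..., n-1}, and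
   mpolyX _ (mnm1 j) is the variable written 'X_j in multinomials. *)
Definition box_poly (R : realType) (d n : nat)
    (c : {ffun 'I_d -> 'I_n} -> int) : mpoly d R[i] :=
  \sum_(k : {ffun 'I_d -> 'I_n})
     (c k)%:~R *: \prod_(j < d) (mpolyX R[i] (mnm1 j)) ^+ k j.

Definition sparse (R : realType) (d n : nat) (s : R)
    (c : {ffun 'I_d -> 'I_n} -> int) : Prop :=
  forall k k' : {ffun 'I_d -> 'I_n}, k != k' -> c k = c k' -> c k != 0 ->
    exists j : 'I_d, s <= `|(k j)%:R - (k' j)%:R|.

(* The values |h(z_1, ..., z_d)| for z_1, ..., z_d in A; Normc.normc is the
   complex modulus with values in R. *)
Definition moduli_on (R : realType) (d : nat) (h : mpoly d R[i])
    (A : set R[i]) : set R :=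
  [set Normc.normc (meval z h) | z in [set z : 'I_d -> R[i] | forall j, A (z j)]].

Definition is_max (R : realType) (S : set R) (M : R) : Prop :=
  S M /\ ubound S M.

(* Main.v *)
(** Write H(theta) for h at (e^{i theta_1}, ..., e^{i theta_d}), s = n^mu, and
    fix a nonzero coefficient c_{k0}. Averaging H e^{-i k0.theta} over
    m ~ 16 n / s shifts of size 1 / n in one coordinate j multiplies the k-th
    coefficient by a number of modulus at most 1, and at most 1/2 as soon as
    |k_j - k0_j| >= s / 2. Doing this q ~ log n times in every coordinate damps
    all coefficients by n^{-d-1}/8, except k0 and at most one more, of opposite
    sign, which a single difference kills at the price of a factor 1 / (4n).
    Hence |H| >= 1 / (8n) somewhere on [0, T]^d, where
    n T = q d m + 1 = O(n^{1-mu} log n).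

    If T <= 1 / L we are done. Otherwise Lagrange interpolation at the n nodes
    j / (n L), one coordinate after another, bounds H on [0, T]^d by
    exp(4 n T L)^d times its maximum on [0, 1 / L]^d; the exponent
    4 d n T L = O(L n^{1-mu} log n) is of the required size. *)

Require Import Defs.
From HB Require Import structures.
From mathcomp Require Import all_boot all_order all_algebra.
From mathcomp Require Import all_classical all_reals all_analysis.
From mathcomp Require Import complex.
From mathcomp Require mpoly.
Import -(notations) mpoly.
From mathcomp Require Import ring lra.

Set Implicit Arguments.
Unset Strict Implicit.
Unset Printing Implicit Defensive.

Import Order.TTheory GRing.Theory Num.Theory.
Local Open Scope ring_scope.

Import Normc numFieldNormedType.Exports.

(** * Complex modulus and chord lengths on the unit circle *)

Section ComplexModulus.
Variable R : realType.
Implicit Types (x y : R) (z w : R[i]).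

Lemma normc_ge0 z : 0 <= normc z.
Proof. by case: z => a b; exact: sqrtr_ge0. Qed.

Lemma normc_triangle z w : normc (z + w) <= normc z + normc w.
Proof. exact: le_normcD. Qed.

Lemma normc_opp z : normc (- z) = normc z.
Proof. exact: normcN. Qed.

Lemma normc_sum (I : Type) (r : seq I) (P : pred I) (F : I -> R[i]) :
  normc (\sum_(i <- r | P i) F i) <= \sum_(i <- r | P i) normc (F i).
Proof.
elim/big_ind2 : _ => [|z x w y zx wy|//]; first by rewrite normc0.
exact: le_trans (normc_triangle _ _) (lerD zx wy).
Qed.

Lemma normc_prod (I : Type) (r : seq I) (P : pred I) (F : I -> R[i]) :
  normc (\prod_(i <- r | P i) F i) = \prod_(i <- r | P i) normc (F i).
Proof. by apply: big_morph; [exact: normcM|exact: normc1]. Qed.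

Lemma normcX z k : normc (z ^+ k) = normc z ^+ k.
Proof. by elim: k => [|k IH]; [rewrite !expr0 normc1|rewrite !exprS normcM IH]. Qed.

Lemma normc_real x : normc (x%:C)%C = `|x|.
Proof. by rewrite /normc/= expr0n addr0 sqrtr_sqr. Qed.

Lemma normc_int (u : int) : normc (u%:~R : R[i]) = `|u%:~R|.
Proof. by rewrite -normc_real rmorph_int. Qed.

Lemma normc_nat k : normc (k%:R : R[i]) = k%:R.
Proof. by rewrite -[k%:R]/(k%:~R) normc_int normr_nat. Qed.

Lemma Im_le_normc z : `|complex.Im z| <= normc z.
Proof.
case: z => a b /=; rewrite -sqrtr_sqr ler_sqrt ?addr_ge0 ?sqr_ge0//.
by rewrite lerDr sqr_ge0.
Qed.

Lemma expi0 : expi (0 : R) = 1.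
Proof. by rewrite /expi cos0 sin0. Qed.

Lemma expiD x y : expi (x + y) = expi x * expi y.
Proof. by rewrite /expi cosD sinD; simpc; rewrite [cos x * sin y + _]addrC. Qed.

Lemma expi_sum (I : Type) (r : seq I) (P : pred I) (F : I -> R) :
  expi (\sum_(i <- r | P i) F i) = \prod_(i <- r | P i) expi (F i).
Proof. by apply: big_morph; [exact: expiD|exact: expi0]. Qed.

Lemma expiM k x : expi (k%:R * x) = expi x ^+ k.
Proof.
elim: k => [|k IH]; first by rewrite mul0r expi0 expr0.
by rewrite exprS -IH -expiD mulrSr mulrDl mul1r addrC.
Qed.

Lemma normc_expi x : normc (expi x) = 1.
Proof. by rewrite /expi /normc cos2Dsin2 sqrtr1. Qed.

(** Both estimates of [sin] come from here: [cos y] is at most 1, and at least 1/2 once [y <= 1]. *)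
Lemma sin_mvt x : 0 <= x -> exists2 y, 0 <= y <= x & sin x = cos y * x.
Proof.
move=> x0; have [|y] := @MVT_segment R sin cos 0 x x0 (fun y _ => is_derive_sin y).
  exact/continuous_subspaceT/continuous_sin.
by rewrite in_itv/= sin0 !subr0 => yx ->; exists y.
Qed.

Lemma normr_sin_le x : `|sin x| <= `|x|.
Proof.
wlog x0 : x / 0 <= x => [H|].
  have [/H//|/ltW x0] := leP 0 x.
  by have := H (- x); rewrite sinN !normrN oppr_ge0; exact.
by have [y _ ->] := sin_mvt x0; rewrite normrM ler_piMl// cos_max.
Qed.

(** Half-angle formula: [cos x] is 1 minus twice the square of [sin (x / 2)]. *)
Lemma cos_ge_quad x : 1 - x ^+ 2 / 2 <= cos x.
Proof.
have {2}-> : x = (x / 2) *+ 2 by rewrite -mulr_natr; field.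
rewrite cos_mulr2n cos2sin2.
have : sin (x / 2) ^+ 2 <= (x / 2) ^+ 2.
  by rewrite -(real_normK (num_real (sin _))) -(real_normK (num_real (x/2)))
             lerXn2r ?nnegrE// normr_sin_le.
by rewrite -[(1 - _) *+ 2]mulr_natr; lra.
Qed.

Lemma normc_expiB1_le x : normc (expi x - 1) <= `|x|.
Proof.
rewrite /expi /normc/= subr0 -sqrtr_sqr ler_sqrt ?sqr_ge0//.
rewrite sqrrB1 -[cos x *+ 2]mulr_natr; have := cos2Dsin2 x; have := cos_ge_quad x; lra.
Qed.

(** The imaginary part [sin x] of the chord already suffices. *)
Lemma normc_expiB1_ge x : `|x| <= 1 -> `|x| / 2 <= normc (expi x - 1).
Proof.
move=> x1; apply: le_trans (Im_le_normc _); rewrite /expi/= subr0.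
wlog x0 : x x1 / 0 <= x => [H|].
  have [/(H _ x1)//|/ltW x0] := leP 0 x.
  by have := H (- x); rewrite sinN !normrN oppr_ge0; exact.
have [y /andP[y0 yx] ->] := sin_mvt x0.
have cy := cos_ge_quad y; rewrite ger0_norm// in x1 *.
have y2 : y ^+ 2 <= 1 by rewrite exprn_ile1// (le_trans yx).
by rewrite (le_trans _ (ler_norm _))// mulrC ler_wpM2r//; lra.
Qed.

Lemma normc_expiB x y : normc (expi x - expi y) = normc (expi (x - y) - 1).
Proof.
have -> : expi x - expi y = expi y * (expi (x - y) - 1).
  by rewrite mulrBr mulr1 -expiD addrCA subrr addr0.
by rewrite normcM normc_expi mul1r.
Qed.

End ComplexModulus.

(** * Trigonometric polynomials on a cube and operators acting on their coefficients *)

Section TrigPoly.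
Variables (R : realType) (d n : nat).
Implicit Types (b : {ffun 'I_d -> 'I_n} -> R[i]) (th : 'I_d -> R) (T M t : R).

(** The coefficients are complex because shifts, averages and differences multiply them by complex
    numbers. *)
Definition trigpoly b th : R[i] :=
  \sum_(k : {ffun 'I_d -> 'I_n}) b k * expi (\sum_(j < d) (k j)%:R * th j).

(** Each operator below becomes a rule that multiplies the coefficients, keeps [M], and pays with a
    decrease of the side [T]. *)
Definition box_bounded b T M : Prop :=
  forall th, (forall j, 0 <= th j <= T) -> normc (trigpoly b th) <= M.

Lemma meval_box_poly (c : {ffun 'I_d -> 'I_n} -> int) th :
  meval (fun j => expi (th j)) (box_poly R c) =
  trigpoly (fun k => (c k)%:~R) th.
Proof.
rewrite /box_poly raddf_sum; apply: eq_bigr => k _ /=.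
rewrite mevalZ rmorph_prod expi_sum; congr (_ * _); apply: eq_bigr => j _.
by rewrite rmorphXn /= mevalXU expiM.
Qed.

Definition shift th (j : 'I_d) t : 'I_d -> R :=
  fun i => if i == j then th i + t else th i.

Lemma trigpoly_shift b th j t :
  trigpoly b (shift th j t) =
  trigpoly (fun k => b k * expi ((k j)%:R * t)) th.
Proof.
apply: eq_bigr => k _; rewrite -mulrA -expiD; congr (_ * expi _).
rewrite (bigD1 j)//= [in RHS](bigD1 j)//= /shift eqxx addrA mulrDr; congr (_ + _).
  by rewrite addrC.
by apply: eq_bigr => i /negPf ->.
Qed.

Lemma box_bounded_shift b T M j t : 0 <= t -> 
  box_bounded b (T + t) M ->
  box_bounded (fun k => b k * expi ((k j)%:R * t)) T M.
Proof.
move=> t0 bM th thT; rewrite -trigpoly_shift; apply: bM => i.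
by have /andP[? ?] := thT i; rewrite /shift; case: ifP => _; apply/andP; split; lra.
Qed.

Lemma box_boundedW b T T' M : T <= T' -> box_bounded b T' M -> box_bounded b T M.
Proof.
move=> TT' bM th thT; apply: bM => j.
by have /andP[-> /le_trans->] := thT j.
Qed.

Lemma box_boundedD b1 b2 T M1 M2 :
  box_bounded b1 T M1 -> box_bounded b2 T M2 ->
  box_bounded (fun k => b1 k + b2 k) T (M1 + M2).
Proof.
move=> H1 H2 th thT; rewrite /trigpoly.
under eq_bigr do rewrite mulrDl.
rewrite big_split/=.
exact: le_trans (normc_triangle _ _) (lerD (H1 _ thT) (H2 _ thT)).
Qed.

Lemma box_boundedZ (a : R[i]) b T M :
  box_bounded b T M -> box_bounded (fun k => a * b k) T (normc a * M).
Proof.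
move=> H th thT; rewrite /trigpoly.
under eq_bigr do rewrite -mulrA.
by rewrite -mulr_sumr normcM ler_wpM2l ?normc_ge0// H.
Qed.

Lemma eq_box_bounded b1 b2 T M : b1 =1 b2 -> box_bounded b1 T M -> box_bounded b2 T M.
Proof. by move=> /funext ->. Qed.

Lemma box_bounded_sum (I : Type) (r : seq I) (F : I -> {ffun 'I_d -> 'I_n} -> R[i]) T
    (G : I -> R) :
  (forall i, box_bounded (F i) T (G i)) ->
  box_bounded (fun k => \sum_(i <- r) F i k) T (\sum_(i <- r) G i).
Proof.
move=> FG; elim: r => [|i r IH].
  rewrite big_nil => th thT; rewrite /trigpoly big1 ?normc0// => k _.
  by rewrite big_nil mul0r.
rewrite big_cons; apply: eq_box_bounded (box_boundedD (FG i) IH) => k.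
by rewrite big_cons.
Qed.

(** The multiplier, at frequency [x], of the mean of the shifts by [0, tau, ..., (m - 1) tau]. *)
Definition avg (m : nat) (tau x : R) : R[i] :=
  m%:R^-1 * \sum_(i < m) expi (x * (i%:R * tau)).

(** Recentring the frequencies at [a] only puts unimodular weights on the shifts, so the bound [M]
    survives. *)
Lemma box_bounded_avg b T M (m : nat) (tau a : R) j : (0 < m)%N -> 0 <= tau ->
  box_bounded b (T + m%:R * tau) M ->
  box_bounded (fun k => b k * avg m tau ((k j)%:R - a)) T M.
Proof.
move=> m0 tau0 bM.
have H (i : 'I_m) : box_bounded (fun k => m%:R^-1 * (expi (- (a * (i%:R * tau))) *
    (b k * expi ((k j)%:R * (i%:R * tau))))) T (m%:R^-1 * M).
  have bMi : box_bounded b (T + i%:R * tau) M.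
    by apply: box_boundedW bM; rewrite lerD2l ler_wpM2r// ler_nat ltnW.
  have := box_bounded_shift j (mulr_ge0 (ler0n _ i) tau0) bMi.
  move=> /(box_boundedZ (expi (- (a * (i%:R * tau))))); rewrite normc_expi mul1r.
  by move=> /(box_boundedZ m%:R^-1); rewrite normcV normc_nat.
have := box_bounded_sum (index_enum _) H.
rewrite sumr_const card_ord -[(_ * M) *+ m]mulr_natl mulVKf ?pnatr_eq0 -?lt0n//.
apply: eq_box_bounded => k; rewrite /avg -mulr_sumr mulrCA; congr (_ * _).
rewrite mulr_sumr; apply: eq_bigr => i _.
by rewrite mulrBl expiD; ring.
Qed.

Lemma normc_avg_le1 (m : nat) (tau x : R) : (0 < m)%N -> normc (avg m tau x) <= 1.
Proof.
move=> m0; rewrite /avg normcM normcV normc_nat ler_pdivrMl ?ltr0n// mulr1.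
apply: le_trans (normc_sum _ _ _) _; under eq_bigr do rewrite normc_expi.
by rewrite sumr_const card_ord.
Qed.

(** Geometric sum: multiplied by [expi (x * tau) - 1], of modulus at least [|x * tau| / 2], the
    average telescopes to a quantity of modulus at most [2 / m]. *)
Lemma normc_avg_le (m : nat) (tau x : R) : (0 < m)%N -> 0 < `|x * tau| <= 1 ->
  normc (avg m tau x) <= 4 / (m%:R * `|x * tau|).
Proof.
move=> m0 /andP[xt0 xt1]; have B := normc_expiB1_ge xt1.
have E : avg m tau x * (expi (x * tau) - 1) =
    m%:R^-1 * (expi (m%:R * (x * tau)) - 1).
  rewrite /avg -mulrA [_ * (_ - 1)]mulrC expiM [in RHS]subrX1.
  by congr (_ * (_ * _)); apply: eq_bigr => i _; rewrite -expiM mulrCA.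
have N : normc (expi (m%:R * (x * tau)) - 1) <= 2.
  by apply: le_trans (normc_triangle _ _) _; rewrite normc_opp normc1 normc_expi; lra.
move: (avg m tau x) E => A E.
have := congr1 (@normc R) E; rewrite !normcM normcV normc_nat => {}E.
rewrite ler_pdivlMr ?mulr_gt0 ?ltr0n// mulrCA -ler_pdivlMl ?ltr0n//.
set y := `|_| in xt0 xt1 B *; have A0 := normc_ge0 A.
have : normc A * (y / 2) <= m%:R^-1 * 2.
  by apply: le_trans (ler_wpM2l A0 B) _; rewrite E ler_wpM2l// invr_ge0 ler0n.
lra.
Qed.

Definition avg_prod m tau (k0 : 'I_d -> R) (k : {ffun 'I_d -> 'I_n}) : R[i] :=
  \prod_(j < d) avg m tau ((k j)%:R - k0 j).

(** Iterates the averaging rule [q] times in each of [d] coordinates; every use costs [m * tau] of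
    the side. *)
Lemma box_bounded_avg_prod b T M (m q : nat) (tau : R) (k0 : 'I_d -> R) :
  (0 < m)%N -> 0 <= tau ->
  box_bounded b (T + (q * d * m)%:R * tau) M ->
  box_bounded (fun k => b k * avg_prod m tau k0 k ^+ q) T M.
Proof.
move=> m0 tau0; elim: q b T => [|q IH] b T bM.
  apply: eq_box_bounded (box_boundedW _ bM) => [k|]; first by rewrite expr0 mulr1.
  by rewrite !mul0n mul0r addr0.
suff bM1 : box_bounded (fun k => b k * avg_prod m tau k0 k) (T + (q * d * m)%:R * tau) M.
  by apply: eq_box_bounded (IH _ _ bM1) => k; rewrite exprS mulrA.
rewrite mulSn mulnDl natrD mulrDl addrA addrAC in bM.
move: (T + (q * _ * _)%:R * tau) bM => {IH}T.
(* With [d] read as the length of the list of coordinates, induction on that list peels off one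
   average at a time. *)
rewrite (_ : (d * m = size (index_enum 'I_d) * m)%N) /avg_prod; last first.
  by congr (_ * _)%N; rewrite [index_enum _]unlock -enumT -cardE card_ord.
elim: (index_enum _) b => [|j r IH] b bM.
  apply: eq_box_bounded (box_boundedW _ bM) => [k|]; first by rewrite big_nil mulr1.
  by rewrite /= mul0n mul0r addr0.
rewrite /= mulSn natrD mulrDl addrA addrAC in bM.
move/(box_bounded_avg (k0 j) j m0 tau0)/IH : bM.
by apply: eq_box_bounded => k; rewrite big_cons mulrA.
Qed.

(** Half the difference between a unimodular multiple of the shift and the identity; the multiplier
    vanishes where [k j] equals [a]. *)
Lemma box_bounded_diff b T M (tau a : R) j : 0 <= tau ->
  box_bounded b (T + tau) M ->
  box_bounded (fun k => b k * ((expi (((k j)%:R - a) * tau) - 1) / 2)) T M.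
Proof.
move=> tau0 bM.
have := box_bounded_shift j tau0 bM.
move=> /(box_boundedZ (expi (- (a * tau)) / 2)); rewrite normcM normc_expi mul1r => H1.
have := box_boundedW (T := T) _ bM; rewrite lerDl => /(_ tau0).
move=> /(box_boundedZ (- 2^-1)); rewrite normc_opp => /(box_boundedD H1).
rewrite normcV (normc_nat R 2) -mulrDl (_ : 2^-1 + 2^-1 = 1) ?mul1r; last by field.
by apply: eq_box_bounded => k; rewrite [(_ - a) * _]mulrBl expiD; ring.
Qed.

End TrigPoly.

(** * Lower bound on a large cube for sparse coefficients *)

Section SparseLowerBound.
Variables (R : realType) (d n : nat).
Local Notation index := {ffun 'I_d -> 'I_n}.
Implicit Types (b w : index -> R[i]) (k : index).

Lemma natr_dist_ge1 (x y : nat) : x != y -> 1 <= `|x%:R - y%:R : R|.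
Proof.
wlog xy : x y / (x <= y)%N => [H|] xny.
  have [/H->//|/ltnW/H] := leqP x y.
  by rewrite distrC; apply; rewrite eq_sym.
by rewrite distrC -natrB// normr_nat ler1n subn_gt0 ltn_neqAle xny.
Qed.

Lemma ord_dist_le (x y : 'I_n) : `|x%:R - y%:R : R| <= n%:R.
Proof.
have xn : (x%:R : R) <= n%:R by rewrite ler_nat ltnW.
have yn : (y%:R : R) <= n%:R by rewrite ler_nat ltnW.
have := ler0n R x; have := ler0n R y.
by rewrite ler_norml => *; apply/andP; split; lra.
Qed.

(** At the origin the polynomial is the sum of its coefficients, of which at most [n ^ d] are other
    than [b k0]. *)
Lemma coef_le_box_bound b T M e k0 : 0 <= T -> box_bounded b T M ->
  (forall k, k != k0 -> normc (b k) <= e) ->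
  0 <= e -> normc (b k0) <= M + (n ^ d)%:R * e.
Proof.
move=> T0 bM be e0.
have /bM : forall j : 'I_d, 0 <= (fun=> 0 : R) j <= T by rewrite lexx.
rewrite /trigpoly; under eq_bigr.
  by move=> k _; rewrite big1 ?expi0 ?mulr1; [over|move=> j _; rewrite mulr0].
rewrite (bigD1 k0)//= => H.
have -> : b k0 = b k0 + \sum_(i | i != k0) b i - \sum_(i | i != k0) b i.
  by rewrite addrK.
apply: le_trans (normc_triangle _ _) (lerD H _); rewrite normc_opp.
apply: le_trans (normc_sum _ _ _) _; apply: le_trans (ler_sum _ be) _.
rewrite sumr_const -[_ *+ _]mulr_natl ler_wpM2r// ler_nat.
by apply: leq_trans (max_card _) _; rewrite card_ffun !card_ord.
Qed.

Lemma avg_prod_center m (tau : R) (k0 : index) : (0 < m)%N ->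
  avg_prod m tau (fun j => (k0 j)%:R : R) k0 = 1.
Proof.
move=> m0; apply: big1 => j _; rewrite subrr /avg.
under eq_bigr do rewrite mul0r expi0.
by rewrite sumr_const card_ord mulVf// pnatr_eq0 -lt0n.
Qed.

(** The step [1 / n] keeps [|x * tau| <= 1]. The far coordinate then contributes at most
    [8 n / (m s) <= 1/2], the others at most 1. *)
Lemma normc_avg_prod_far m (s : R) k0 k (j : 'I_d) : (0 < m)%N -> 0 < s ->
  16 * n%:R <= m%:R * s -> s / 2 <= `|(k j)%:R - (k0 j)%:R| ->
  normc (avg_prod m n%:R^-1 (fun j => (k0 j)%:R : R) k) <= 2^-1.
Proof.
move=> m0 s0 nms kj; rewrite /avg_prod (bigD1 j)//= normcM.
have n0 : 0 < n%:R :> R by rewrite ltr0n (leq_trans _ (ltn_ord (k j))).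
have m0R : 0 < m%:R :> R by rewrite ltr0n.
set x := _ - _ in kj *; have x0 : 0 < `|x| by lra.
have xn : `|x| <= n%:R by exact: ord_dist_le.
have xtau : `|x * n%:R^-1| = `|x| / n%:R by rewrite normrM (@ger0_norm _ n%:R^-1) ?invr_ge0 ?ltW.
rewrite -[2^-1]mulr1; apply: ler_pM; rewrite ?normc_ge0//; last first.
  by rewrite normc_prod; apply: prodr_ile1 => i _; rewrite normc_ge0 normc_avg_le1.
apply: le_trans (normc_avg_le _ _) _ => //; rewrite xtau.
  by rewrite divr_gt0//= ler_pdivrMr// mul1r.
rewrite ler_pdivrMr ?mulr_gt0 ?invr_gt0//.
have -> : 2^-1 * (m%:R * (`|x| / n%:R)) = (m%:R * `|x| / 2) / n%:R by ring.
rewrite ler_pdivlMr//.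
have : m%:R * (s / 2) <= m%:R * `|x| by rewrite ler_wpM2l// ltW.
lra.
Qed.

(* Two coefficients of the sign opposite to [c k0] cannot both lie within
   [s / 2] of [k0], so a single difference operator removes the only one which
   the averages leave undamped. *)
Lemma isolate_coef (c : index -> int) (s : R) k0 :
  (0 < n)%N -> (forall k, c k \in [:: 0; 1; -1]) -> sparse s c -> 0 < s -> c k0 != 0 ->
  exists w, [/\
    (forall b T M, box_bounded b (T + n%:R^-1) M ->
       box_bounded (fun k => b k * w k) T M),
    (forall k, normc (w k) <= 1),
    (4 * n%:R)^-1 <= normc (w k0) &
    (forall k, k != k0 -> c k != 0 -> w k != 0 ->
       exists j, s / 2 <= `|(k j)%:R - (k0 j)%:R|)].
Proof.
move=> n0 c01 sp s0 ck0.
have n1 : 1 <= n%:R :> R by rewrite ler1n.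
have ni0 : 0 <= n%:R^-1 :> R by rewrite invr_ge0 ler0n.
pose near k := [forall j, `|(k j)%:R - (k0 j)%:R : R| < s / 2].
have farP k : ~~ near k -> exists j, s / 2 <= `|(k j)%:R - (k0 j)%:R : R|.
  by rewrite negb_forall => /existsP[j]; rewrite -leNgt; exists j.
have same k : k != k0 -> c k = c k0 -> ~~ near k.
  move=> kk0 ckk0; have [|j sj] := sp k k0 kk0 ckk0; first by rewrite ckk0.
  by apply/negP => /forallP/(_ j); apply/negP; rewrite -leNgt; lra.
(* Only two nonzero values are available, so two that differ from [c k0] agree. *)
have opposite k k' : c k != 0 -> c k' != 0 -> c k != c k0 -> c k' != c k0 -> c k = c k'.
  move: (c01 k) (c01 k') (c01 k0) ck0; rewrite !inE.
  by case/or3P => /eqP ->; case/or3P => /eqP ->; case/or3P => /eqP ->.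
have [k1 /and3P[k10 ck1 nk1]|nok1] :=
    pickP (fun k => [&& k != k0, c k != 0 & near k]); last first.
  exists (fun=> 1); split => [b T M|k||k kk0 ck _].
  - have TT : T <= T + n%:R^-1 by rewrite lerDl.
    by move=> /(box_boundedW TT); apply: eq_box_bounded => k; rewrite mulr1.
  - by rewrite normc1.
  - by rewrite normc1 invf_le1 ?mulr_gt0//; lra.
  - by apply: farP; have := nok1 k; rewrite kk0 ck /= => ->.
(* A difference in a coordinate [j] where [k1] and [k0] disagree kills [k1] but not [k0]. *)
have /ffunP/existsNP[j /eqP k01j] : ~ k1 = k0 by apply/eqP.
have D k : `|((k j)%:R - (k1 j)%:R) * n%:R^-1 : R| <= 1.
  rewrite normrM (ger0_norm ni0) -[leLHS]/(_ / n%:R) ler_pdivrMr ?mul1r ?ord_dist_le//.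
  by rewrite ltr0n.
exists (fun k => (expi (((k j)%:R - (k1 j)%:R) * n%:R^-1) - 1) / 2); split.
- by move=> b T M bM; exact: box_bounded_diff.
- move=> k; rewrite normcM normcV (normc_nat R 2).
  have := normc_expiB1_le (((k j)%:R - (k1 j)%:R) * n%:R^-1 : R).
  have := D k; lra.
(* The integers [k0 j] and [k1 j] are at least 1 apart, so the chord is at least [1 / (2 n)]; the
   halving gives [1 / (4 n)]. *)
- rewrite normcM normcV (normc_nat R 2).
  have := normc_expiB1_ge (D k0); rewrite normrM (ger0_norm ni0).
  have : 1 * n%:R^-1 <= `|(k0 j)%:R - (k1 j)%:R| * n%:R^-1 :> R.
    by rewrite ler_wpM2r// natr_dist_ge1// eq_sym.
  rewrite invfM; lra.
(* A further near index would have the same sign as [k1] and, by the triangle inequality through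
   [k0], lie within less than [s] of it in every coordinate. *)
- move=> k kk0 ck wk; apply: farP; apply/negP => nk.
  have kk1 : k != k1 by apply: contraNneq wk => ->; rewrite subrr mul0r expi0 subrr mul0r.
  have ckk0 : c k != c k0 by apply: contraTneq nk => /(same k kk0).
  have ck1k0 : c k1 != c k0 by apply: contraTneq nk1 => /(same k1 k10).
  have [//|i] := sp k k1 kk1 (opposite _ _ ck ck1 ckk0 ck1k0).
  have /forallP/(_ i) := nk; have /forallP/(_ i) := nk1; rewrite distrC => H1 H2.
  have := ler_normD ((k i)%:R - (k0 i)%:R : R) ((k0 i)%:R - (k1 i)%:R).
  rewrite addrA subrK; lra.
Qed.

(** After isolation and damping, the coefficient at [k0] is at least [1 / (4 n)] and all others sum
    to at most [n ^ d / 2 ^ q <= 1 / (8 n)]. *)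
Lemma sparse_box_lower (c : index -> int) (s : R) (m q : nat) (M : R) k0 :
  (forall k, c k \in [:: 0; 1; -1]) -> sparse s c -> 0 < s -> c k0 != 0 ->
  (0 < n)%N -> (0 < m)%N -> 16 * n%:R <= m%:R * s ->
  (8 * n ^ d.+1 <= 2 ^ q)%N ->
  box_bounded (fun k => (c k)%:~R) ((q * d * m).+1%:R / n%:R) M ->
  (8 * n%:R)^-1 <= M.
Proof.
move=> c01 sp s0 ck0 n0 m0 nms nq.
have n0R : 0 < n%:R :> R by rewrite ltr0n.
have [w [wM w1 wk0 far]] := isolate_coef n0 c01 sp s0 ck0.
(* The extra [1 / n] of the side pays for the isolating multiplier; the averages use up the rest and
   leave only the origin. *)
rewrite -addn1 natrD mulrDl mul1r => /wM.
rewrite -[_ / _]add0r => /box_bounded_avg_prod-/(_ (fun j => (k0 j)%:R) m0).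
rewrite invr_ge0 ler0n => /(_ isT) bM.
have := coef_le_box_bound (lexx 0) bM (k0 := k0) (e := 2^-1 ^+ q).
rewrite avg_prod_center// expr1n mulr1 normcM.
have cabs k : normc ((c k)%:~R : R[i]) <= 1.
  by rewrite normc_int; have := c01 k; rewrite !inE => /or3P[]/eqP ->;
     rewrite ?normr0 ?ler01// ?normrN normr1.
have -> : normc ((c k0)%:~R : R[i]) = 1.
  by rewrite normc_int; have := c01 k0; rewrite !inE (negPf ck0) /= => /orP[]/eqP ->;
     rewrite ?normrN normr1.
rewrite mul1r => H.
have {}H : normc (w k0) <= M + (n ^ d)%:R * 2^-1 ^+ q.
  apply: H; last by rewrite exprn_ge0// invr_ge0.
  move=> k kk0; rewrite !normcM normcX.
  have e0 : 0 <= 2^-1 ^+ q :> R by rewrite exprn_ge0// invr_ge0.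
  have [->|ck] := eqVneq (c k) 0; first by rewrite normc0 !mul0r.
  have [->|wk] := eqVneq (w k) 0; first by rewrite normc0 mulr0 mul0r.
  have [j kj] := far k kk0 ck wk.
  rewrite -[leRHS]mul1r ler_pM ?mulr_ge0 ?exprn_ge0 ?normc_ge0//.
    by rewrite mulr_ile1 ?normc_ge0.
  by rewrite lerXn2r ?nnegrE ?normc_ge0 ?invr_ge0//; exact: normc_avg_prod_far kj.
have : (n ^ d)%:R * 2^-1 ^+ q <= (8 * n%:R)^-1 :> R.
  rewrite exprVn -[leLHS]/(_ / _) ler_pdivrMr ?exprn_gt0// mulrC ler_pdivlMr ?mulr_gt0//.
  by rewrite mulrCA -!natrX -!natrM ler_nat -expnSr.
move: wk0; rewrite !invfM; lra.
Qed.

End SparseLowerBound.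

(** * Lagrange interpolation on an arc and extension from a small cube to a large one *)

Section Interpolation.

(** The difference between [p] and its interpolant has size at most [n] and [n] distinct roots. *)
Lemma lagrange_eval (F : fieldType) (n : nat) (x : 'I_n -> F) (p : {poly F}) z :
  injective x -> (size p <= n)%N ->
  p.[z] = \sum_(i < n) p.[x i] * \prod_(j < n | j != i) ((z - x j) / (x i - x j)).
Proof.
move=> xI szp.
pose l i : {poly F} := \prod_(j < n | j != i) ((x i - x j)^-1 *: ('X - (x j)%:P)).
have lE i y : (l i).[y] = \prod_(j < n | j != i) ((y - x j) / (x i - x j)).
  by rewrite horner_prod; apply: eq_bigr => j _; rewrite hornerZ hornerXsubC mulrC.
have sl i : (size (l i) <= n)%N.
  have n0 : (0 < n)%N by apply: leq_ltn_trans (ltn_ord i).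
  rewrite /l scaler_prod (leq_trans (size_scale_leq _ _))//.
  rewrite (eq_bigl (mem (predC1 i)))// -big_enum size_prod_XsubC.
  by rewrite -cardE cardC1 card_ord prednK.
suff {1}-> : p = \sum_(i < n) p.[x i] *: l i.
  by rewrite horner_sum; apply: eq_bigr => i _; rewrite hornerZ lE.
apply/eqP; rewrite -subr_eq0; apply/eqP.
apply: (@roots_geq_poly_eq0 _ _ [seq x i | i <- enum 'I_n]).
- apply/allP => _ /mapP[i _ ->]; rewrite /root hornerD hornerN horner_sum.
  rewrite (bigD1 i)//= hornerZ lE big1 => [|j ji]; last first.
    by rewrite divff// subr_eq0 (inj_eq xI) eq_sym.
  rewrite mulr1 big1 ?addr0 ?subrr// => j ji.
  by rewrite hornerZ lE (bigD1 i) 1?eq_sym//= subrr mul0r mul0r mulr0.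
- by rewrite map_inj_uniq ?enum_uniq.
- rewrite size_map size_enum_ord (leq_trans (size_polyD _ _))// geq_max szp size_polyN.
  apply: (leq_trans (size_sum _ _ _)); apply/bigmax_leqP => i _.
  exact: leq_trans (size_scale_leq _ _) (sl i).
Qed.

Variable R : realType.

(** The indices below [i] contribute [i!], those above it [(n - i)!]. *)
Lemma prod_dist_fact (n : nat) (i : 'I_n.+1) :
  \prod_(j < n.+1 | j != i) `|i%:R - j%:R : R| = (i`! * (n - i)`!)%:R.
Proof.
rewrite -(big_mkord (fun j => j != i) (fun j => `|i%:R - j%:R|)).
have i_le : (i <= n.+1)%N by apply: ltnW.
rewrite (big_cat_nat _ i_le)//= (big_ltn_cond (ltn_ord i)) eqxx natrM; congr (_ * _).
  rewrite -ffactnn ffact_prod natr_prod -(big_mkord xpredT (fun j => (i - j)%:R)).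
  rewrite big_nat_cond [RHS]big_nat_cond; apply: eq_big => j.
    by case: ltngtP => //; rewrite ?andbF ?andbT.
  by move=> /andP[/andP[_ ji] _]; rewrite -natrB ?normr_nat// ltnW.
rewrite /= fact_prod [in RHS]big_add1 natr_prod -{1}[i.+1]add0n big_addn subSS.
rewrite big_nat_cond [RHS]big_nat_cond; apply: eq_big => j.
  by rewrite gtn_eqF ?andbT// addnS ltnS leq_addl.
by move=> _; rewrite distrC -natrB addnS ?leqW ?leq_addl// subSn ?leq_addl// addnK normr_nat.
Qed.

Lemma expR_ge_exprn (x : R) n : 0 <= x -> x ^+ n / n`!%:R <= expR x.
Proof.
case: n => [|n] x0; first by rewrite expr0 divr1 -expR0 ler_expR.
by apply: le_trans (expR_ge1Dxn n x0); rewrite lerDr.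
Qed.

(* The Lagrange basis at [n + 1] equally spaced nodes sums to at most
   [(2 T / h)^n * sum_i 1 / (i! (n - i)!) = (4 T / h)^n / n!], an exponential
   term. *)
Lemma interpolation_bound (n : nat) (p : {poly R[i]}) (h t T M : R) :
  (size p <= n.+1)%N -> 0 < h -> n%:R * h <= 1 -> n%:R * h <= T -> 0 <= t <= T ->
  (forall i : 'I_n.+1, normc p.[expi (i%:R * h)] <= M) ->
  normc p.[expi t] <= expR (4 * T / h) * M.
Proof.
move=> sp h0 nh1 nhT /andP[t0 tT] pM.
have T0 : 0 <= T by apply: le_trans tT.
have M0 : 0 <= M by apply: le_trans (normc_ge0 _) (pM ord0).
have node (i : 'I_n.+1) : 0 <= i%:R * h <= n%:R * h.
  by rewrite mulr_ge0 ?ler0n ?(ltW h0)//= ler_wpM2r ?(ltW h0)// ler_nat -ltnS.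
(* All nodes lie in [[0, 1]], where a chord is at least half its arc. *)
have lo (i j : 'I_n.+1) : `|i%:R - j%:R : R| * (h / 2) <=
    normc (expi (i%:R * h) - expi (j%:R * h) : R[i]).
  rewrite normc_expiB -mulrBl.
  have -> : `|i%:R - j%:R : R| * (h / 2) = `|(i%:R - j%:R) * h| / 2.
    by rewrite normrM (ger0_norm (ltW h0)) mulrA.
  apply: normc_expiB1_ge; rewrite mulrBl.
  by have := node i; have := node j; rewrite ler_norml => /andP[? ?] /andP[? ?];
     apply/andP; split; lra.
have hi (j : 'I_n.+1) : normc (expi t - expi (j%:R * h) : R[i]) <= T.
  rewrite normc_expiB; apply: le_trans (normc_expiB1_le _) _.
  by have := node j; rewrite ler_norml => /andP[? ?]; apply/andP; split; lra.
have xI : injective (fun i : 'I_n.+1 => expi (i%:R * h) : R[i]).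
  move=> i j /= E; apply/val_inj/eqP/negPn/negP => ij.
  have := lo i j; rewrite E subrr normc0; apply/negP; rewrite -ltNge.
  by rewrite mulr_gt0 ?divr_gt0// (lt_le_trans ltr01)// natr_dist_ge1.
rewrite (lagrange_eval _ xI sp); apply: le_trans (normc_sum _ _ _) _.
have B (i : 'I_n.+1) : normc (p.[expi (i%:R * h)] * \prod_(j < n.+1 | j != i)
    ((expi t - expi (j%:R * h)) / (expi (i%:R * h) - expi (j%:R * h)))) <=
    M * ((2 * T / h) ^+ n / n`!%:R * ('C(n, i))%:R).
  rewrite normcM ler_pM ?normc_ge0// normc_prod.
  have -> : (2 * T / h) ^+ n / n`!%:R * ('C(n, i))%:R =
      \prod_(j < n.+1 | j != i) ((2 * T / h) / `|i%:R - j%:R : R|).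
    rewrite big_split /= prodr_const cardC1 card_ord prodfV prod_dist_fact.
    rewrite -mulrA; congr (_ * _).
    have iln : (i <= n)%N by rewrite -ltnS.
    rewrite -[X in X%:R^-1 * _](bin_fact iln) natrM invfM mulrAC mulVf ?mul1r//.
    by rewrite pnatr_eq0 -lt0n bin_gt0.
  apply: ler_prod => j ji; rewrite normc_ge0 andTb normcM normcV.
  have dij : 0 < `|i%:R - j%:R : R|.
    by rewrite (lt_le_trans ltr01)// natr_dist_ge1// eq_sym.
  have -> : 2 * T / h / `|i%:R - j%:R| = T / (`|i%:R - j%:R| * (h / 2)).
    by field; rewrite !gt_eqF.
  have l0 : 0 < `|i%:R - j%:R : R| * (h / 2) by rewrite mulr_gt0 ?divr_gt0.
  rewrite ler_pM ?normc_ge0 ?invr_ge0 ?normc_ge0// lef_pV2 ?posrE//.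
  exact: lt_le_trans (lo i j).
apply: le_trans (ler_sum _ (fun i _ => B i)) _.
rewrite -mulr_sumr mulrC ler_wpM2r// -mulr_sumr -natr_sum.
have -> : (\sum_(i < n.+1) 'C(n, i) = 2 ^ n)%N.
  by rewrite -[2%N]/(1 + 1)%N expnDn; apply: eq_bigr => i _; rewrite !exp1n !muln1.
apply: le_trans (expR_ge_exprn n _); last by rewrite divr_ge0 ?mulr_ge0 ?(ltW h0).
by rewrite mulrAC natrX -exprMn (_ : 2 * T / h * 2 = 4 * T / h)//; ring.
Qed.

Variables (d n : nat).
Local Notation index := {ffun 'I_d -> 'I_n.+1}.

Definition update (th : 'I_d -> R) (j : 'I_d) (t : R) : 'I_d -> R :=
  fun i => if i == j then t else th i.

(** With the other angles frozen, the sum has degree at most [n] in [expi t], so [n + 1] nodes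
    determine it. *)
Lemma trigpoly_slice (b : index -> R[i]) th j : exists2 p : {poly R[i]},
  (size p <= n.+1)%N & forall t, trigpoly b (update th j t) = p.[expi t].
Proof.
exists (\sum_k (b k * expi (\sum_(i | i != j) (k i)%:R * th i)) *: 'X^(k j)).
  apply: (leq_trans (size_sum _ _ _)); apply/bigmax_leqP => k _.
  by rewrite (leq_trans (size_scale_leq _ _))// size_polyXn.
move=> t; rewrite horner_sum; apply: eq_bigr => k _.
rewrite hornerZ hornerXn -expiM -mulrA -expiD; congr (_ * expi _).
rewrite (bigD1 j)//= /update eqxx addrC; congr (_ + _).
by apply: eq_bigr => i /negPf ->.
Qed.

(** The coordinates are released from [[0, eps]] to [[0, T]] one at a time, each at the price of one
    exponential factor. *)
Lemma box_bounded_extend (b : index -> R[i]) (eps T M : R) :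
  0 < eps <= 1 -> eps <= T -> box_bounded b eps M ->
  box_bounded b T (expR (4 * n.+1%:R * T / eps) ^+ d * M).
Proof.
move=> /andP[eps0 eps1] epsT bM.
suff H r : (r <= d)%N -> forall th,
    (forall j : 'I_d, 0 <= th j <= if (j < r)%N then T else eps) ->
    normc (trigpoly b th) <= expR (4 * n.+1%:R * T / eps) ^+ r * M.
  by move=> th thT; apply: H => // j; rewrite ltn_ord.
elim: r => [_ th thT|r IH rd th thT]; first by rewrite expr0 mul1r; exact: bM.
pose j := Ordinal rd; have [p sp pE] := trigpoly_slice b th j.
have n0 : 0 < n.+1%:R :> R by rewrite ltr0n.
(* The nodes [i * eps / (n + 1)] with [i <= n] stay inside [[0, eps]]. *)
have nh : n%:R * (eps / n.+1%:R) <= eps.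
  rewrite mulrCA ler_piMr ?(ltW eps0)// ler_pdivrMr// mul1r ler_nat.
  exact: ltnW.
have -> : th = update th j (th j).
  by apply/funext => i; rewrite /update; case: eqP => [->|].
have := thT j; rewrite ltnS leqnn => tj.
rewrite pE exprS -mulrA.
have -> : 4 * n.+1%:R * T / eps = 4 * T / (eps / n.+1%:R).
  by field; rewrite gt_eqF// gt_eqF.
apply: interpolation_bound sp _ (le_trans nh eps1) (le_trans nh epsT) tj _.
  by rewrite divr_gt0.
move=> i; rewrite -pE.
have -> : 4 * T / (eps / n.+1%:R) = 4 * n.+1%:R * T / eps.
  by field; rewrite gt_eqF// gt_eqF.
(* At a node the coordinate [r] is back in [[0, eps]], as the induction hypothesis requires. *)
apply: (IH (ltnW rd)) => l; rewrite /update.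
case: eqP => [->|/eqP lj] /=.
  rewrite ltnn mulr_ge0 ?divr_ge0 ?(ltW eps0)//=; apply: le_trans nh.
  by rewrite ler_wpM2r ?divr_ge0 ?(ltW eps0)// ler_nat -ltnS.
by have := thT l; rewrite ltnS leq_eqVlt (negPf (lj : l != r :> nat)).
Qed.

End Interpolation.

(** * Existence of the maximum, and passage from arcs to angles *)

Section Maximum.
Variables (R : realType) (d n : nat).

Lemma continuous_normc (T : topologicalType) (f : T -> R[i]) :
  continuous (fun x => complex.Re (f x) : R) ->
  continuous (fun x => complex.Im (f x) : R) ->
  continuous (fun x => normc (f x)).
Proof.
move=> cRe cIm.
have -> : (fun x => normc (f x)) =
    (fun x => Num.sqrt (complex.Re (f x) ^+ 2 + complex.Im (f x) ^+ 2)).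
  by apply/funext => x; case: (f x).
move=> x; apply: (@continuous_comp _ _ _
  (fun x => complex.Re (f x) ^+ 2 + complex.Im (f x) ^+ 2) Num.sqrt); last first.
  exact: sqrt_continuous.
exact: (continuousD (continuousM (cRe x) (cRe x)) (continuousM (cIm x) (cIm x))).
Qed.

Lemma continuous_trigpoly_normc (b : {ffun 'I_d -> 'I_n} -> R[i]) :
  continuous (fun v : 'rV[R]_d => normc (trigpoly b (v ord0))).
Proof.
have lin (k : {ffun 'I_d -> 'I_n}) :
    continuous (fun v : 'rV[R]_d => \sum_(j < d) (k j)%:R * v ord0 j : R).
  apply: (continuous_big (op := +%R)) => [|j _ v]; first exact: add_continuous.
  have cj : continuous (fun v : 'rV[R]_d => v ord0 j : R) by exact: coord_continuous.
  exact: (continuousM (@cst_continuous _ _ ((k j)%:R : R) v) (cj v)).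
have cc (k : {ffun 'I_d -> 'I_n}) :
    continuous (fun v : 'rV[R]_d => cos (\sum_(j < d) (k j)%:R * v ord0 j) : R).
  by move=> v; apply: continuous_comp; [exact: lin|exact: continuous_cos].
have cs (k : {ffun 'I_d -> 'I_n}) :
    continuous (fun v : 'rV[R]_d => sin (\sum_(j < d) (k j)%:R * v ord0 j) : R).
  by move=> v; apply: continuous_comp; [exact: lin|exact: continuous_sin].
apply: continuous_normc.
- under eq_fun do rewrite /trigpoly raddf_sum.
  apply: (continuous_big (op := +%R)) => [|k _]; first exact: add_continuous.
  rewrite /expi; case: (b k) => x y /= v.
  exact: (continuousB (continuousM (@cst_continuous _ _ x v) (cc k v))
                      (continuousM (@cst_continuous _ _ y v) (cs k v))).
- under eq_fun do rewrite /trigpoly raddf_sum.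
  apply: (continuous_big (op := +%R)) => [|k _]; first exact: add_continuous.
  rewrite /expi; case: (b k) => x y /= v.
  exact: (continuousD (continuousM (@cst_continuous _ _ x v) (cs k v))
                      (continuousM (@cst_continuous _ _ y v) (cc k v))).
Qed.

(** The angles range over a compact cube of row vectors, on which the modulus is continuous. *)
Lemma moduli_on_max (c : {ffun 'I_d -> 'I_n} -> int) (L : R) : 0 < L ->
  exists M, is_max (moduli_on (box_poly R c) (gamma L)) M.
Proof.
move=> L0.
pose A := [set v : 'rV[R]_d | forall j,
  (`[- (pi / L), pi / L]%classic : set R) (v ord0 j)]%classic.
have pL : 0 <= pi / L by rewrite divr_ge0 ?pi_ge0 ?ltW.
have cA : compact A.
  by apply: (@rV_compact R d (fun=> `[- (pi / L), pi / L]%classic)) => j; exact: segment_compact.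
have A0 : (A !=set0)%classic.
  by exists 0 => j /=; rewrite mxE in_itv/= oppr_le0 pL.
have [v vA vmax] := EVT_max_rV A0 cA
  (continuous_subspaceT (continuous_trigpoly_normc (b := fun k => (c k)%:~R))).
exists (normc (trigpoly (fun k => (c k)%:~R) (v ord0))); split.
  exists (fun j => expi (v ord0 j)); last by rewrite meval_box_poly.
  by move: vA; rewrite inE => vA j /=; exists (v ord0 j) => //; have := vA j; rewrite /= in_itv.
move=> _ [z zA <-].
have /choice[th thz] : forall j, exists t, - (pi / L) <= t <= pi / L /\ expi t = z j.
  by move=> j; have [t tL <-] := zA j; exists t.
rewrite (meval_eq (v2 := fun j => expi (th j))); last first.
  by move=> j; have [_ ->] := thz j.
rewrite meval_box_poly.
have := vmax (\row_j th j).
have -> : (\row_j th j) ord0 = th by apply/funext => j; rewrite mxE.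
by apply; rewrite inE => j /=; rewrite mxE in_itv/=; have [] := thz j.
Qed.

(** Since [pi >= 1], angles in [[0, 1 / L]] give points of [gamma L]. *)
Lemma is_max_box_bounded (c : {ffun 'I_d -> 'I_n} -> int) (L M : R) : 0 < L ->
  is_max (moduli_on (box_poly R c) (gamma L)) M ->
  box_bounded (fun k => (c k)%:~R) L^-1 M.
Proof.
move=> L0 [_ ubM] th thL; apply: ubM.
exists (fun j => expi (th j)); last by rewrite meval_box_poly.
move=> j /=; exists (th j) => //=; have /andP[t0 tL] := thL j.
have Li : 0 <= L^-1 by rewrite invr_ge0 ltW.
have := @pi_ge2 R => p2.
have piL : L^-1 <= pi / L by rewrite ler_peMl// (le_trans _ p2)// ler1n.
by apply/andP; split; lra.
Qed.

End Maximum.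

(** * Choice of parameters and conclusion *)

(** Rounding up adds at most 1 to the binary logarithm, which is itself at least 1. *)
Lemma up_log2_le (R : realType) (n : nat) : (1 < n)%N ->
  (up_log 2 n)%:R <= 2 / ln 2 * ln n%:R :> R.
Proof.
move=> n1; have l2 : 0 < ln 2 :> R by rewrite ln_gt0// ltr1n.
have u0 : (0 < up_log 2 n)%N by rewrite up_log_gt0.
have n0 : 0 < n%:R :> R by rewrite ltr0n ltnW.
have H1 : (up_log 2 n).-1%:R * ln 2 <= ln n%:R :> R.
  rewrite mulr_natl -lnXn// ler_ln ?posrE ?exprn_gt0// -natrX ler_nat.
  by rewrite ltnW// up_log_gtn.
have H2 : ln 2 <= ln n%:R :> R by rewrite ler_ln ?posrE// ler_nat.
rewrite mulrAC ler_pdivlMr// -(prednK u0) -natr1 mulrDl mul1r.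
lra.
Qed.

Lemma box_poly_neq0_coef (R : realType) (d n : nat)
    (c : {ffun 'I_d -> 'I_n} -> int) :
  box_poly R c != 0 -> exists k, c k != 0.
Proof.
move=> h0; apply/existsP; apply: contraNT h0 => /existsPn c0.
by rewrite /box_poly big1// => k _; rewrite (eqP (negPn (c0 k))) scale0r.
Qed.

Theorem theorem1p2 (R : realType) (d : nat) (mu : R) :
  (1 <= d)%N -> 0 <= mu < 1 ->
  exists C : R, 0 < C /\
    forall (n : nat) (c : {ffun 'I_d -> 'I_n} -> int),
      (forall k, c k \in [:: 0; 1; -1]) ->
      sparse (n%:R `^ mu) c ->
      box_poly R c != 0 ->
      forall Delta L : R, 1 <= Delta -> 1 <= L -> L <= n%:R `^ Delta ->
        exists M : R,
          is_max (moduli_on (box_poly R c) (gamma L)) M /\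
          expR (- (C * Delta * L * n%:R `^ (1 - mu) * ln n%:R)) <= M.
Proof.
move=> d0 /andP[mu0 mu1].
have l2 : 0 < ln 2 :> R by rewrite ln_gt0// ltr1n.
(* [A] is chosen for [N T <= A X ln N]: 17 comes from [m], [d + 4] and [2 / ln 2] from [q], and the
   final 1 from the difference step. *)
have [A A0 AE] : exists2 A : R, 0 <= A &
    A = 2 / ln 2 * (17 * d%:R * (d + 4)%:R + 1).
  by eexists; last reflexivity; rewrite mulr_ge0 ?divr_ge0 ?addr_ge0 ?mulr_ge0 ?(ltW l2).
(* The 4 absorbs the loss [1 / (8 N)], the other term the interpolation factor. *)
exists (4 + 4 * d%:R * A); split.
  by rewrite ltr_wpDr// !mulr_ge0.
move=> n c c01 sp /box_poly_neq0_coef[k0 ck0] Delta L D1 L1 _.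
have L0 : 0 < L by apply: lt_le_trans L1.
have [M maxM] := moduli_on_max c L0; exists M; split=> //.
have bM := is_max_box_bounded L0 maxM.
have Li0 : 0 < L^-1 by rewrite invr_gt0.
have Li1 : L^-1 <= 1 by rewrite invf_le1.
(* As [d >= 1], the index [k0] provides an element of ['I_n], which excludes [n = 0]. *)
have := k0 (Ordinal d0).
case: n c c01 sp k0 ck0 {maxM} bM => [|[|n]] c c01 sp k0 ck0 bM; first by case.
  (* For [n = 1] the required bound is 1, and [k0] is the only index. *)
  move=> _; rewrite ln1 mulr0 oppr0 expR0.
  have := coef_le_box_bound (e := 0) (k0 := k0) (ltW Li0) bM.
  rewrite mulr0 addr0 normc_int; move=> H; apply: le_trans (H _ (lexx _)).
    by have := c01 k0; rewrite !inE (negPf ck0) /= => /orP[]/eqP ->;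
       rewrite ?normrN normr1.
  by move=> k /eqP[]; apply/ffunP => j; rewrite [LHS]ord1 [RHS]ord1.
move=> _; set N := n.+2 in c c01 sp k0 ck0 bM *.
have N0 : 0 < N%:R :> R by rewrite ltr0n.
have N2 : 2 <= N%:R :> R by rewrite ler_nat.
set X : R := N%:R `^ (1 - mu).
have X1 : 1 <= X by rewrite -(powRr0 N%:R) ler_powR ?ler1n// subr_ge0 ltW.
have NX : N%:R = X * N%:R `^ mu.
  rewrite -powRD; last by rewrite (gt_eqF N0) implybT.
  by rewrite subrK powRr1// ltW.
(* [m] exceeds [16 N / s] for [s = N^mu], and [2 ^ q] is at least [N ^ (d + 4)], hence at least
   [8 * N ^ (d + 1)]. *)
pose m := (Num.truncn (16 * X)).+1; pose q := ((d + 4) * up_log 2 N)%N.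
have m17 : m%:R <= 17 * X.
  have : (Num.truncn (16 * X))%:R <= 16 * X by rewrite truncn_le// mulr_ge0// (le_trans _ X1).
  rewrite /m -natr1; lra.
have s0 : 0 < N%:R `^ mu by rewrite powR_gt0.
have mN : 16 * N%:R <= m%:R * N%:R `^ mu.
  rewrite [in leLHS]NX mulrA ler_wpM2r ?(ltW s0)// ltW//.
  exact: truncnS_gt.
have qN : (8 * N ^ d.+1 <= 2 ^ q)%N.
  have Nu : (N <= 2 ^ up_log 2 N)%N by exact: up_logP.
  rewrite /q [((d + 4) * _)%N]mulnC expnM (_ : d + 4 = 3 + d.+1)%N; last by rewrite addnS addnC.
  rewrite expnD leq_mul// ?leq_exp2r//.
  by rewrite -[8%N]/(2 ^ 3)%N leq_exp2r// (leq_trans _ Nu).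
set l := ln N%:R; have l0 : 0 < l by rewrite ln_gt0// ltr1n.
pose T : R := (q * d * m).+1%:R / N%:R.
have T0 : 0 < T by rewrite divr_gt0.
have lower M' : box_bounded (fun k => (c k)%:~R) T M' -> (8 * N%:R)^-1 <= M'.
  exact: (sparse_box_lower c01 sp s0 ck0 _ _ mN qN).
have u : (up_log 2 N)%:R <= 2 / ln 2 * l :> R by exact: up_log2_le.
have NT : N%:R * T <= A * (l * X).
  have -> : N%:R * T = (q * d * m).+1%:R by rewrite mulrC divfK// gt_eqF.
  have u1 : 1 <= (up_log 2 N)%:R :> R by rewrite ler1n up_log_gt0.
  set v := 2 / ln 2 * l in u; have v0 : 0 <= v by apply: le_trans u; exact: ler0n.
  have -> : A * (l * X) = v * (d + 4)%:R * d%:R * (17 * X) + v * X.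
    by rewrite AE /v; ring.
  rewrite -natr1 lerD//; last by rewrite -[1]mulr1 ler_pM// (le_trans u1).
  rewrite !natrM ler_pM ?mulr_ge0 ?ler0n// ler_wpM2r ?ler0n//.
  by rewrite mulrC ler_wpM2r ?ler0n.
(* Here [N >= 2] gives [8 N <= N ^ 4]. *)
have e8 : expR (- (4 * l)) <= (8 * N%:R)^-1.
  rewrite expRN lef_pV2 ?posrE ?expR_gt0 ?mulr_gt0//.
  rewrite (expRM_natl 4) lnK ?posrE// exprS mulrC ler_wpM2l ?(ltW N0)//.
  have : 2 ^+ 3 <= N%:R ^+ 3 :> R by rewrite lerXn2r ?nnegrE ?(ltW N0).
  by rewrite -natrX.
have grow (B : R) : 0 <= B -> B * L * (l * X) <= B * Delta * L * X * l.
  move=> B0; have -> : B * Delta * L * X * l = Delta * (B * L * (l * X)) by ring.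
  by rewrite ler_peMl// !mulr_ge0// ?(ltW L0) ?(ltW l0)// (le_trans _ X1).
have g4 : 4 * l <= 4 * Delta * L * X * l.
  apply: le_trans (grow 4 _) => //; rewrite -mulrA ler_wpM2l//.
  rewrite mulrCA ler_peMr ?(ltW l0)//; nra.
have -> : (4 + 4 * d%:R * A) * Delta * L * X * l =
   4 * Delta * L * X * l + (4 * d%:R * A) * Delta * L * X * l by ring.
have dA0 : 0 <= 4 * d%:R * A by rewrite !mulr_ge0.
have D0 : 0 <= (4 * d%:R * A) * L * (l * X).
  by rewrite mulr_ge0 ?mulr_ge0 ?(ltW L0) ?(ltW l0)// (le_trans _ X1).
(* If [T <= 1 / L], the bound on the smaller cube applies to [M] directly. *)
have [TL|/ltW TL] := leP T L^-1.
  apply: le_trans (lower M (box_boundedW TL bM)); apply: le_trans e8.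
  rewrite ler_expR lerN2; have := grow _ dA0; lra.
have eps01 : 0 < L^-1 <= 1 by rewrite Li0.
(* Otherwise [expR E * M] bounds the polynomial on the cube of side [T], with [E = 4 d N T L]. *)
have := lower _ (box_bounded_extend eps01 TL bM).
rewrite -expRM_natl invrK; set E : R := d%:R * _ => lowM.
have EL : E <= 4 * d%:R * A * L * (l * X).
  rewrite /E; have -> : d%:R * (4 * N%:R * T * L) = 4 * d%:R * L * (N%:R * T) by ring.
  have -> : 4 * d%:R * A * L * (l * X) = 4 * d%:R * L * (A * (l * X)) by ring.
  by rewrite ler_wpM2l// !mulr_ge0// ltW.
rewrite -(ler_pM2l (expR_gt0 E)) -expRD; apply: le_trans lowM; apply: le_trans e8.
rewrite ler_expR; have := grow _ dA0; lra.
Qed.
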